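(* Let $G$ be a finite directed multigraph with vertex set $\{1,\ldots,n\}$ and adjacency matrix $M=(m_{ij})$, where $m_{ij}$ is the number of edges from $i$ to $j$ (loops allowed). Let $\mathbf{q}=(q_i)$ and $\mathbf{s}=(s_i)$ be vectors of nonnegative integers, and put $\mathbf{in}=\mathbf{q}M$, i.e. $\mathbf{in}_j=\sum_i q_i m_{ij}$. Then the number of quota forests over $G$ with quota $\mathbf{q}$ and start portfolio exactly $\mathbf{s}$ equals the quota symbol $$\left\{\begin{array}{c}\mathbf{in}\\ \mathbf{q}-\mathbf{s}\end{array}\right\}_G .$$
   Context: Quota symbol: for vectors $\mathbf{a}=(a_i)$, $\mathbf{b}=(b_i)$ of length $n$, $$\left\{\begin{array}{c}\mathbf{a}\\ \mathbf{b}\end{array}\right\}_G:=\det M(\mathbf{a},\mathbf{b})\prod_i\binom{a_i}{b_i}(a_i)^{-1},\qquad M(\mathbf{a},\mathbf{b})=\mathrm{diag}(\mathbf{a})-M\,\mathrm{diag}(\mathbf{b}),$$ where the binomial coefficient $\binom{m}{k}$ is zero unless $0\le k\le m$, and for any index $i$ with $a_i=0$ the factor $a_i^{-1}$ is omitted and the corresponding row and column of $M(\mathbf{a},\mathbf{b})$ are deleted (the determinant of the empty matrix is $1$). A map $f:T\to G$ of directed multigraphs sends vertices to vertices, edges to edges, and respects initial and terminal vertices; it is an immersion if for every vertex $v$ it is injective on the set of outgoing edges of $v$. A quota tree with root $r\in V(G)$ and quota $q$ is an immersion $f:T\to G$, where $T$ is a finite rooted tree with all edges directed away from its root, the root maps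 to $r$, and $|f^{-1}(v)|=q(v)$ for all $v\in V(G)$. Two quota trees are identified if there is an isomorphism of rooted trees between them commuting with the maps to $G$. A quota forest with start portfolio $\mathbf{s}$ is a family of quota trees $(T_{v,k})_{v\in V(G),\,1\le k\le s_v}$ with $T_{v,k}$ rooted at $v$; its quota is the sum of the quotas of its components. The roots are distinguishable: forests are counted as indexed families, so permuting non-isomorphic trees with the same root vertex gives a different forest. *)

(* Defs.v *)
From HB Require Import structures.
From mathcomp Require Import all_boot all_order all_algebra.

Set Implicit Arguments.
Unset Strict Implicit.
Unset Printing Implicit Defensive.

Import GRing.Theory.
Local Open Scope ring_scope.

Record multigraph (V : finType) := Multigraph {
  edge : finType;
  src : edge -> V;
  tgt : edge -> V
}.

Definition adjmx n (G : multigraph 'I_n) : 'M[nat]_n :=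
  \matrix_(i, j) #|[set e : edge G | (src e == i) && (tgt e == j)]|.

(* A walk is recorded by its sequence of edges, since parallel edges give
   different walks. *)
Fixpoint walk (V : finType) (G : multigraph V) (x : V) (p : seq (edge G))
    (y : V) : bool :=
  if p is e :: p' then (src e == x) && walk (tgt e) p' y else x == y.

(* A rooted tree with all edges directed away from the root [r]; taking [y := r]
   shows that no edge enters the root. *)
Definition rooted_tree (V : finType) (T : multigraph V) (r : V) : Prop :=
  forall y : V, exists! p : seq (edge T), walk r p y.

Definition graph_map (V W : finType) (T : multigraph V) (G : multigraph W)
    (fv : V -> W) (fe : edge T -> edge G) : Prop :=
  forall e, src (fe e) = fv (src e) /\ tgt (fe e) = fv (tgt e).

Definition immersion (V W : finType) (T : multigraph V) (G : multigraph W)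
    (fv : V -> W) (fe : edge T -> edge G) : Prop :=
  graph_map fv fe /\
  forall v, {in [set e : edge T | src e == v] &, injective fe}.

Record quota_tree (V : finType) (G : multigraph V) (r : V) := QuotaTree {
  node : finType;
  tree : multigraph node;
  root : node;
  vmap : node -> V;
  emap : edge tree -> edge G;
  tree_rooted : rooted_tree tree root;
  tree_immersion : immersion vmap emap;
  tree_root : vmap root = r
}.

Definition tree_quota (V : finType) (G : multigraph V) (r : V)
    (t : quota_tree G r) (v : V) : nat :=
  #|[set x : node t | vmap x == v]|.

Definition tree_iso (V : finType) (G : multigraph V) (r : V)
    (t t' : quota_tree G r) : Prop :=
  exists (hv : node t -> node t') (he : edge (tree t) -> edge (tree t')),
    [/\ bijective hv, bijective he, graph_map hv he, hv (root t) = root t'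
      & (forall x, vmap (hv x) = vmap x) /\ (forall e, emap (he e) = emap e)].

Definition quota_forest n (G : multigraph 'I_n) (s : 'rV[nat]_n) : Type :=
  forall v : 'I_n, 'I_(s 0 v) -> quota_tree G v.

Definition forest_quota n (G : multigraph 'I_n) (s : 'rV[nat]_n)
    (F : quota_forest G s) : 'rV[nat]_n :=
  \row_w (\sum_(v < n) \sum_(k < s 0%R v) tree_quota (F v k) w)%N.

(* The trees are compared index by index, so permuting non-isomorphic trees
   with the same root vertex gives a different forest. *)
Definition forest_iso n (G : multigraph 'I_n) (s : 'rV[nat]_n)
    (F F' : quota_forest G s) : Prop :=
  forall v k, tree_iso (F v k) (F' v k).

(* Exactly [N] elements satisfying [P] up to the equivalence relation [R],
   witnessed by a complete system of pairwise inequivalent representatives. *)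
Definition count_upto (T : Type) (R : T -> T -> Prop) (P : T -> Prop)
    (N : nat) : Prop :=
  exists rep : 'I_N -> T,
    [/\ forall i, P (rep i),
        forall i j, R (rep i) (rep j) -> i = j
      & forall x, P x -> exists i, R x (rep i)].

Definition binz (m k : int) : nat :=
  if (0 <= k) && (k <= m) then 'C(`|m|, `|k|) else 0%N.

Definition rowz n (v : 'rV[nat]_n) : 'rV[int]_n := map_mx Posz v.

Definition quota_mx n (G : multigraph 'I_n) (a b : 'rV[int]_n) : 'M[int]_n :=
  diag_mx a - map_mx Posz (adjmx G) *m diag_mx b.

(* [0^-1 = 0], so the indices with [a_i = 0] are excluded explicitly, both from
   the product of inverses and from the rows and columns of the determinant. *)
Definition quota_symbol n (G : multigraph 'I_n) (a b : 'rV[int]_n) : rat :=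
  let S := [set i : 'I_n | a 0 i != 0] in
  let A := mxsub (@enum_val _ (mem S)) (@enum_val _ (mem S)) (quota_mx G a b) in
  (\det A)%:~R * (\prod_i (binz (a 0 i) (b 0 i))%:R) *
    \prod_(i in S) ((a 0 i)%:~R)^-1.

(* Main.v *)
Require Import Defs.
From HB Require Import structures.
From mathcomp Require Import all_boot all_order all_algebra.
From mathcomp Require Import zify.

Set Implicit Arguments.
Unset Strict Implicit.
Unset Printing Implicit Defensive.

Import Order.TTheory GRing.Theory Num.Theory.
Local Open Scope ring_scope.

(** Up to isomorphism a quota tree is the finite prefix-closed set of walks of
    [G] from its root that are the images of the branches of the tree, so a quota
    forest is a set of nodes, closed under taking parents, in the forest of all
    walks started at the roots prescribed by [s] ([tree_words_iso],
    [iso_tree_words], [tree_of_words]).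

    Such a forest is revealed one node at a time: choose a node that is not yet
    decided and whose parent is in the forest, and decide whether it is in the
    forest.  When [a j] slots of type [j] (outgoing edges to [j] of nodes of the
    forest, already met or still to come) are undecided and [b j] of them are
    still to be filled, the decision about a slot of type [j] replaces [a] by
    [a - e_j], and [b] by [b] or [b - e_j].  The number of completions therefore
    satisfies Pascal's rule in each pair [(a j, b j)].

    The quota symbol satisfies the same rule.  Multiplying column [j] of
    M(a,b) by binom(a_j, b_j) / a_j turns a_j into binom(a_j, b_j) and b_j into
    binom(a_j - 1, b_j - 1); both obey Pascal's rule, and since column [j] is the
    only one that involves a_j and b_j, multilinearity transfers the rule to the
    determinant ([slot_detS]).  This [slot_det] needs no division, and equals the
    quota symbol, degenerate indices included ([quota_symbolE]).

    The process stops when no slot of a node found so far is undecided.  All the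
    remaining quota [q'] would then be needed for nodes that have no way to
    appear, so the count is 1 if [q' = 0] and 0 otherwise.  Then a = q'M and
    b = q', and the determinant agrees: for [q' = 0] the matrix is the identity,
    and otherwise [q'] is a nonzero vector in its kernel ([slot_det_full]).
    The induction along the process is [card_quota_subforests]. *)

(** * Binomial coefficients with and without a forced slot *)

Definition bin_free (a : nat) (b : int) : int := (binz a b)%:Z.

(** This is binom(a - 1, b - 1).  At [a = 0] the value is that of
    binom(-1, b - 1), the coefficient of x^b in x/(1+x): among the choices
    vanishing for [b <= 0] it is the only one for which Pascal's rule holds from
    [a = 0] on. *)
Definition bin_forced (a : nat) (b : int) : int :=
  if a is a'.+1 then bin_free a' (b - 1)
  else if b is Posz b'.+1 then (-1) ^+ b' else 0.

Lemma bin_free_pos a k : bin_free a (Posz k) = 'C(a, k)%:Z.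
Proof.
rewrite /bin_free /binz /= lez_nat; case: leqP => // ltak.
by rewrite bin_small.
Qed.

Lemma bin_free_neg a b : b < 0 -> bin_free a b = 0.
Proof. by case: b => // b _; rewrite /bin_free /binz. Qed.

Lemma bin_free0 a : bin_free a 0 = 1.
Proof. by rewrite -[0]/(Posz 0) bin_free_pos bin0. Qed.

Lemma bin_forced_le0 a b : b <= 0 -> bin_forced a b = 0.
Proof.
move=> b_le0; case: a => [|a] /=; first by case: b b_le0 => [[|b]|b].
by apply: bin_free_neg; lia.
Qed.

Lemma bin_freeS a b : bin_free a.+1 b = bin_free a b + bin_free a (b - 1).
Proof.
case: b => [[|k]|k].
- by rewrite !bin_free_pos !bin0 bin_free_neg // addr0.
- have ->: Posz k.+1 - 1 = Posz k by lia.
  by rewrite !bin_free_pos binS.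
- by rewrite !bin_free_neg //; lia.
Qed.

Lemma bin_forcedS a b :
  bin_forced a.+1 b = bin_forced a b + bin_forced a (b - 1).
Proof.
case: a => [|a]; last exact: bin_freeS.
case: b => [[|[|k]]|k] //.
have ->: Posz k.+2 - 1 = Posz k.+1 by lia.
by rewrite [LHS]bin_free_pos /= exprS mulN1r addNr.
Qed.

Lemma bin_forced_absorb a b : a%:Z * bin_forced a b = bin_free a b * b.
Proof.
case: b => [[|k]|k].
- by rewrite bin_forced_le0 // !mulr0.
- case: a => [|a]; first by rewrite mul0r bin_free_pos.
  rewrite /= (_ : Posz k.+1 - 1 = Posz k); last by lia.
  by rewrite !bin_free_pos -!PoszM mul_bin_diag mulnC.
- by rewrite bin_forced_le0 // bin_free_neg // mulr0 mul0r.
Qed.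

(** * The quota symbol as a determinant obeying Pascal's rule *)

(** The transpose of diag(a) - M diag(b), with row [i] multiplied by
    binom(a_i, b_i) / a_i when [a i != 0].  Transposing makes the parameters of
    index [i] occur in row [i] only. *)
Definition slot_mx n (M : 'M[nat]_n) (a : 'I_n -> nat) (b : 'I_n -> int) :
    'M[int]_n :=
  \matrix_(i, j) ((i == j)%:R * bin_free (a i) (b i)
                  - (M j i)%:Z * bin_forced (a i) (b i)).

Definition slot_det n (M : 'M[nat]_n) a b : int := \det (slot_mx M a b).

Lemma eq_slot_det n (M : 'M[nat]_n) a a' b b' :
  a =1 a' -> b =1 b' -> slot_det M a b = slot_det M a' b'.
Proof.
move=> eq_a eq_b; congr (\det _).
by apply/matrixP => i j; rewrite !mxE eq_a eq_b.
Qed.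

(** By Pascal's rule row [i0] is the sum of the two rows obtained by leaving the
    extra slot empty or filling it; the other rows do not change. *)
Lemma slot_detS n (M : 'M[nat]_n) a b i0 :
  slot_det M (fun i => (a i + (i == i0))%N) b =
  slot_det M a b + slot_det M a (fun i => b i - (i == i0)%:Z).
Proof.
rewrite /slot_det -[X in X + _]mul1r -[X in _ + X]mul1r.
apply: (@determinant_multilinear _ _ _ _ _ i0).
- apply/rowP => j; rewrite !mxE eqxx !mul1r addn1 bin_freeS bin_forcedS.
  by rewrite mulrDr mulrDr opprD addrACA.
- by apply/matrixP => i j;
     rewrite !mxE !(eq_sym (lift _ _)) !(negPf (neq_lift _ _)) addn0.
- by apply/matrixP => i j;
     rewrite !mxE !(eq_sym (lift _ _)) !(negPf (neq_lift _ _)) addn0 subr0.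
Qed.

Lemma slot_det_neg n (M : 'M[nat]_n) a b i : b i < 0 -> slot_det M a b = 0.
Proof.
move=> b_lt0; rewrite /slot_det (expand_det_row _ i) big1 // => j _.
rewrite mxE bin_free_neg // bin_forced_le0; last by lia.
by rewrite !mulr0 subrr mul0r.
Qed.

(** For [q = 0] the matrix is the identity.  Otherwise [q] is in its kernel: by
    the absorption identity a binom(a-1, b-1) = b binom(a, b), row [i] times [q] is
    q_i binom(a_i, q_i) - a_i binom(a_i - 1, q_i - 1) = 0, as a_i is the sum of
    the q_k m_ki. *)
Lemma slot_det_full n (M : 'M[nat]_n) (q : 'I_n -> nat) :
  slot_det M (fun j => \sum_i q i * M i j)%N (fun i => q i)
  = [forall i, q i == 0%N]%:R.
Proof.
case: forallP => [q0 | q_neq0].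
  have {}q0 i : q i = 0%N by apply/eqP.
  rewrite -[RHS](det1 int n) /slot_det; congr (\det _).
  apply/matrixP => i j; rewrite !mxE q0 bin_free0 mulr1.
  by rewrite bin_forced_le0 // mulr0 subr0.
apply/eqP; rewrite /slot_det -det_tr; apply/det0P.
exists (\row_i (q i)%:Z).
  apply: contra_notN q_neq0 => /eqP/rowP q0 i.
  have := q0 i; by rewrite !mxE; lia.
apply/rowP => i; rewrite !mxE.
set a := (\sum_k q k * M k i)%N.
have aE : a%:Z = \sum_k (q k)%:Z * (M k i)%:Z.
  rewrite /a (big_morph Posz PoszD (erefl _)).
  by apply: eq_bigr => k _; rewrite PoszM.
transitivity (\sum_k ((q k)%:Z * ((i == k)%:R * bin_free a (q i))
    - (q k)%:Z * (M k i)%:Z * bin_forced a (q i))).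
  by apply: eq_bigr => k _; rewrite !mxE mulrBr -[in RHS]mulrA.
rewrite sumrB -mulr_suml -aE bin_forced_absorb mulrC; apply/eqP.
rewrite subr_eq0; apply/eqP.
rewrite (bigD1 i) //= eqxx mul1r big1 ?addr0 // => k /negPf.
by rewrite eq_sym => ->; rewrite mul0r mulr0.
Qed.

(** A type [i0] without slots has no incoming edge from a type [j] with
    [0 < q j], so the entry of row [i0] off the diagonal vanishes at every [j]
    with [b j != 0]; so does the diagonal entry, by binom(0, b_i0) = 0.  Where
    [b j = 0] row [j] is a unit vector, so these rows span row [i0]. *)
Lemma slot_det_dead n (M : 'M[nat]_n) (q s : 'I_n -> nat) i0 :
  let a j := (\sum_i q i * M i j)%N in let b i := (q i)%:Z - (s i)%:Z in
  (forall i, 0 <= b i) -> a i0 = 0%N -> b i0 != 0 -> slot_det M a b = 0.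
Proof.
move=> a b b_ge0 a0 b0; apply/eqP/det0P.
(* Row [i0] minus the unit rows, each with the coefficient that cancels it. *)
exists (\row_j ((j == i0)%:R - (b j == 0)%:R * slot_mx M a b i0 j)).
  apply: contraNneq b0 => /rowP/(_ i0); rewrite !mxE eqxx.
  by case: eqP => // _; rewrite mul0r subr0.
have row_unit i j : b i = 0 -> slot_mx M a b i j = (i == j)%:R.
  by move=> bi0; rewrite mxE bi0 bin_free0 bin_forced_le0 // mulr1 mulr0 subr0.
have row0 j : b j != 0 -> slot_mx M a b i0 j = (i0 == j)%:R * bin_free 0 (b i0).
  move=> bj; rewrite mxE a0; suff -> : M j i0 = 0%N by rewrite mul0r subr0.
  move/eqP: a0; rewrite sum_nat_eq0 => /forallP/(_ j).
  rewrite /= muln_eq0 => /orP[/eqP qj0 | /eqP //].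
  have := b_ge0 j; move: bj; by rewrite /b qj0; lia.
move: (slot_mx M a b) row_unit row0 => K row_unit row0.
apply/rowP => j; rewrite !mxE.
rewrite (eq_bigr (fun i => (i == i0)%:R * K i0 j
    - ((b i == 0)%:R * K i0 i) * (i == j)%:R)); last first.
  move=> i _; rewrite !mxE mulrBl; congr (_ - _).
    by case: eqP => [->|]; rewrite ?mul0r ?mul1r.
  by case: eqP => [/row_unit->|]; rewrite ?mul0r.
rewrite sumrB (bigD1 i0) //= eqxx mul1r big1 ?addr0; last first.
  by move=> i /negPf->; rewrite mul0r.
rewrite (bigD1 j) //= eqxx mulr1 big1 ?addr0; last first.
  by move=> i /negPf->; rewrite mulr0.
case: (eqVneq (b j) 0) => bj; first by rewrite mul1r subrr.
rewrite mul0r subr0 row0 //.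
have := b_ge0 i0; case: (b i0) b0 => // -[//|k] _ _.
by rewrite bin_free_pos bin0n mulr0.
Qed.

(** Both sides are Schur complements of the same block matrix with identity
    diagonal blocks. *)
Lemma det_1addmulC (R : comPzRingType) m n (X : 'M[R]_(m, n)) (Y : 'M[R]_(n, m)) :
  \det (1%:M + X *m Y) = \det (1%:M + Y *m X).
Proof.
pose B := block_mx 1%:M (- X) Y 1%:M; pose U := block_mx 1%:M X 0 1%:M.
have detU : \det U = 1 by rewrite det_ublock !det1 mulr1.
transitivity (\det (U *m B)).
  rewrite mulmx_block !mul1mx !mul0mx !mulmx1 !add0r addNr.
  by rewrite det_lblock det1 mulr1.
rewrite det_mulmx mulrC -det_mulmx mulmx_block !mul1mx !mulmx1 !mulmx0 !addr0.
by rewrite subrr det_lblock det1 mul1r addrC.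
Qed.

(** As [A - 1] vanishes on the rows outside [S], it factors through the
    coordinates in [S]; exchanging the two factors leaves the minor on [S]. *)
Lemma det_unit_rows (R : comPzRingType) n (S : {set 'I_n}) (A : 'M[R]_n) :
  (forall i j, i \notin S -> A i j = (i == j)%:R) ->
  \det A = \det (mxsub (@enum_val _ (mem S)) (@enum_val _ (mem S)) A).
Proof.
move=> unitA; pose f := @enum_val _ (mem S).
pose X : 'M[R]_(n, #|S|) := colsub f 1%:M.
pose Y := rowsub f (A - 1%:M).
transitivity (\det (1%:M + X *m Y));
  [congr (\det _) | rewrite det_1addmulC; congr (\det _)].
  apply/matrixP => i j; rewrite !mxE.
  rewrite (eq_bigr (fun k => (fun l => (i == l)%:R * (A l j - (l == j)%:R)) (f k)));
    last by move=> k _; rewrite !mxE.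
  rewrite -(big_enum_val (fun l => (i == l)%:R * (A l j - (l == j)%:R))) /=.
  have [iS | iS] := boolP (i \in S); last first.
    rewrite unitA // big1 ?addr0 // => k kS; case: eqP => [ik|]; last by rewrite mul0r.
    by rewrite ik kS in iS.
  rewrite (bigD1 i) //= eqxx mul1r big1 ?addr0 ?subrKC // => k /andP[_ /negPf].
  by rewrite eq_sym => ->; rewrite mul0r.
apply/matrixP => i j; rewrite !mxE (bigD1 (f j)) //= big1 ?addr0.
  by rewrite !mxE eqxx mulr1 (inj_eq enum_val_inj) subrKC.
by move=> k /negPf kj; rewrite !mxE kj mulr0.
Qed.

(** On indices with [a i != 0] the two determinants differ by the row factors
    binom(a_i, b_i) / a_i.  An index with [a i = 0] has a unit row if [b i = 0],
    which explains its deletion, and makes both sides vanish otherwise. *)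
Lemma quota_symbolE n (G : multigraph 'I_n) (q s : 'rV[nat]_n) :
  let M := adjmx G in
  quota_symbol G (rowz (q *m M)) (rowz q - rowz s) =
  (slot_det M (fun j => \sum_i q 0%R i * M i j)%N
     (fun i => (q 0%R i)%:Z - (s 0%R i)%:Z))%:~R.
Proof.
set M := adjmx G => /=.
set a := fun j => (\sum_i q 0%R i * M i j)%N.
set b := fun i : 'I_n => (q 0 i)%:Z - (s 0 i)%:Z.
have aE i : rowz (q *m M) 0 i = (a i)%:Z by rewrite !mxE.
have bE i : (rowz q - rowz s) 0 i = b i by rewrite !mxE.
have QE i j : quota_mx G (rowz (q *m M)) (rowz q - rowz s) i j
    = (j == i)%:R * (a j)%:Z - (M i j)%:Z * b j.
  rewrite /quota_mx mul_mx_diag; move: aE bE.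
  move: (rowz (q *m M)) (rowz q - rowz s) => x y aE bE.
  by rewrite 4!mxE aE mxE bE eq_sym mulr_natl; case: eqP => [->|].
rewrite /quota_symbol; set S := [set i | _].
have aS i : (i \in S) = (a i != 0%N) by rewrite inE aE.
have [/existsP[i b_lt0] | b_ge0] := boolP [exists i, b i < 0].
  rewrite (slot_det_neg _ _ b_lt0) (bigD1 i) //= aE bE.
  by rewrite [binz _ _](_ : _ = 0%N) ?mul0r ?mulr0 ?mul0r // /binz leNgt b_lt0.
have {}b_ge0 i : 0 <= b i.
  by move: b_ge0; rewrite negb_exists => /forallP/(_ i); rewrite -leNgt.
have [/existsP[i /andP[/eqP ai0 bi]] | dead] :=
    boolP [exists i, (a i == 0%N) && (b i != 0)].
  rewrite (slot_det_dead (i0 := i)) // (bigD1 i) //= aE bE ai0.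
  rewrite [binz _ _](_ : _ = 0%N) ?mul0r ?mulr0 ?mul0r // /binz b_ge0 /=.
  by rewrite leNgt lt0r bi b_ge0.
have {dead} b0 i : a i = 0%N -> b i = 0.
  move=> ai; apply/eqP; move: dead; rewrite negb_exists => /forallP/(_ i).
  by rewrite ai eqxx negbK.
rewrite /slot_det (det_unit_rows (S := S)); last first.
  move=> i j; rewrite aS negbK => /eqP ai; rewrite mxE (b0 _ ai) bin_free0.
  by rewrite bin_forced_le0 // mulr1 mulr0 subr0.
pose f := @enum_val _ (mem S); rewrite -/f.
have -> : \prod_i (binz (rowz (q *m M) 0 i) ((rowz q - rowz s) 0 i))%:R =
          \prod_(i in S) (bin_free (a i) (b i))%:~R :> rat.
  rewrite [RHS]big_mkcond; apply: eq_bigr => i _; rewrite aE bE aS.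
  by case: eqP => [ai | _] //=; rewrite ai b0.
rewrite -mulrA -big_split /=.
rewrite (big_enum_val (fun i => (bin_free (a i) (b i))%:~R *
   ((rowz (q *m M) 0 i)%:~R)^-1)) /= -/f.
rewrite -!det_map_mx mulrC -det_tr.
set d := \row_k ((bin_free (a (f k)) (b (f k)))%:~R *
  ((rowz (q *m M) 0 (f k))%:~R)^-1 : rat).
rewrite (eq_bigr (fun k => d 0 k)); last by move=> k _; rewrite [RHS]mxE.
rewrite -det_diag -det_mulmx; congr (\det _).
apply/matrixP => k l; rewrite mul_diag_mx [LHS]mxE.
have -> : d 0 k = (bin_free (a (f k)) (b (f k)))%:~R / (a (f k))%:~R.
  by rewrite mxE aE.
rewrite [_^T k l]mxE ![map_mx _ _ _ _]mxE ![mxsub _ _ _ _ _]mxE QE.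
have ak : (a (f k))%:~R != 0 :> rat.
  by rewrite intr_eq0; have := enum_valP k; rewrite inE aE.
apply: (mulfI ak); rewrite mulrA mulrCA mulfV // mulr1.
rewrite -!intrM; congr (_%:~R); rewrite [slot_mx _ _ _ _ _]mxE.
rewrite mulrBr [RHS]mulrBr; congr (_ - _).
  by rewrite [RHS]mulrC [RHS]mulrAC mulrC.
by rewrite mulrCA [RHS]mulrCA bin_forced_absorb.
Qed.

(** * Counting subforests by revealing them one node at a time *)

(** The ambient forest is a set of nodes with a parent function, meaningful outside
    the set [rt] of roots, and a type for each node.  It is the truncation of an
    infinite forest: a node of depth less than [m] has [M i j] children of type
    [j] if its type is [i], while nodes of depth [m] may lack children. *)
Section RootedSubforests.

Variables (n m : nat) (W : finType) (par : W -> W) (rt : {set W}).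
Variables (depth : W -> nat) (ty : W -> 'I_n) (M : 'M[nat]_n).

Hypothesis depth_rt : forall x, x \in rt -> depth x = 0%N.
Hypothesis depth_par : forall x, x \notin rt -> depth x = (depth (par x)).+1.
Hypothesis card_children : forall x j, (depth x < m)%N ->
  #|[set y | [&& y \notin rt, par y == x & ty y == j]]| = M (ty x) j.

Definition type_count (A : {set W}) j := #|[set x in A | ty x == j]|.

Definition subforest (L : {set W}) :=
  (rt \subset L) && [forall y in L, (y \notin rt) ==> (par y \in L)].

Lemma subforestP (L : {set W}) :
  reflect ((rt \subset L) /\ {in L, forall y, y \notin rt -> par y \in L})
    (subforest L).
Proof.
apply: (iffP andP) => -[rtL parL]; split=> //.
  by move=> y yL; move/forall_inP/(_ y yL)/implyP: parL.
by apply/forall_inP => y yL; apply/implyP/parL.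
Qed.

Lemma type_countS (A B : {set W}) j :
  A \subset B -> (type_count A j <= type_count B j)%N.
Proof.
move=> /subsetP sAB; apply/subset_leq_card/subsetP => x.
by rewrite !inE => /andP[/sAB-> ->].
Qed.

Lemma type_countU1 (A : {set W}) y j :
  y \notin A -> type_count (y |: A) j = (type_count A j + (j == ty y))%N.
Proof.
move=> yA; rewrite /type_count (cardsD1 y) !inE eqxx /= addnC eq_sym.
congr (_ + _)%N; congr #|pred_of_set _|; apply/setP => x; rewrite !inE.
by case: eqP => [->|] //=; rewrite (negPf yA).
Qed.

Lemma sum_type_count (A : {set W}) (F : 'I_n -> nat) :
  (\sum_(x in A) F (ty x) = \sum_j type_count A j * F j)%N.
Proof.
rewrite (partition_big ty predT) //=; apply: eq_bigr => j _.
rewrite -sum_nat_const; apply: eq_big => [x | x /andP[_ /eqP->] //].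
by rewrite inE.
Qed.

(** The ancestors of [x] are in [L], one at each depth from 0 to that of [x].
    Hence the subforests of a small enough quota never reach the truncation. *)
Lemma subforest_depth (L : {set W}) x : subforest L -> x \in L -> (depth x < #|L|)%N.
Proof.
move=> /subforestP[_ parL] xL.
suff below k y : y \in L -> depth y = k ->
    (k < #|[set z in L | depth z <= k]|)%N.
  apply: leq_trans (below _ _ xL (erefl _)) _.
  by apply/subset_leq_card/subsetP => z; rewrite inE => /andP[].
elim: k y => [|k IHk] y yL dy.
  by apply/card_gt0P; exists y; rewrite inE yL dy.
have yrt : y \notin rt by apply/negP => /depth_rt; rewrite dy.
have dp : depth (par y) = k by move: dy; rewrite depth_par // => -[].
apply: leq_ltn_trans (IHk _ (parL _ yL yrt) dp) _.
apply/proper_card/properP; split; last first.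
  by exists y; rewrite !inE yL dy ?leqnn ?ltnn.
by apply/subsetP => z; rewrite !inE => /andP[-> /leqW].
Qed.

(** Double counting: the children of the nodes of [I] are grouped by parent, then
    the parents by type. *)
Lemma card_children_of (I : {set W}) j :
  {in I, forall x, (depth x < m)%N} ->
  #|[set y | [&& y \notin rt, par y \in I & ty y == j]]| =
  (\sum_i type_count I i * M i j)%N.
Proof.
move=> shallow; rewrite -(sum_type_count I (fun i => M i j)).
rewrite -sum1_card (partition_big par (fun x => x \in I)) /=; last first.
  by move=> y; rewrite inE => /and3P[].
apply: eq_bigr => x xI; rewrite -card_children ?shallow // -sum1_card.
apply: eq_bigl => y; rewrite !inE.
by case: (par y =P x) => [->|_]; rewrite ?xI ?andbF //= andbT.
Qed.

Variable q : 'I_n -> nat.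
Hypothesis sum_q : (\sum_i q i <= m)%N.

(** The state of the revealing process: the nodes of [D] are decided, and those
    of them that are in the forest form [I]. *)
Definition quota_subforests (D I : {set W}) : {set {set W}} :=
  [set L | [&& subforest L, L :&: D == I & [forall j, type_count L j == q j]]].

(** Induction on the number of undecided nodes.  Slots of type [j] correspond to
    the children of type [j] of nodes in the forest, in total sum_i q_i m_ij; the
    decided nonroots are the slots already dealt with.  Deciding one more child
    of [I] is an instance of [slot_detS].  If all children of [I] are decided, the
    forest cannot grow beyond [I], and [slot_det_full] applies to the quota that
    is left. *)
Lemma card_quota_subforests (D I : {set W}) :
  I \subset D -> subforest I ->
  {in D, forall y, y \notin rt -> par y \in I} ->
  #|quota_subforests D I|%:Z =
  slot_det M (fun j => \sum_i q i * M i j - type_count (D :\: rt) j)%N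
    (fun j => (q j)%:Z - (type_count I j)%:Z).
Proof.
have [k] := ubnP #|~: D|; elim: k D I => // k IHk D I ltk sID sfI parD.
have [/existsP[j lt_qj] | ] := boolP [exists j, q j < type_count I j]%N.
  rewrite (slot_det_neg _ _ (i := j)); last by lia.
  rewrite [quota_subforests _ _](_ : _ = set0) ?cards0 //.
  apply/setP => L; rewrite !inE; apply/and3P => -[_ /eqP LD /forallP/(_ j)/eqP qL].
  by move: lt_qj; rewrite -qL ltnNge type_countS // -LD subsetIl.
rewrite negb_exists => /forallP le_q.
have {}le_q j : (type_count I j <= q j)%N by rewrite leqNgt.
have shallow : {in I, forall x, (depth x < m)%N}.
  move=> x xI; apply: leq_trans (subforest_depth sfI xI) (leq_trans _ sum_q).
  rewrite -sum1_card (sum_type_count _ (fun=> 1%N)).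
  by apply: leq_sum => j _; rewrite muln1.
have /subforestP[rtI parI] := sfI.
have card_ch j := card_children_of j shallow.
have [/existsP[y /andP[yD yI]] | ] := boolP [exists y, (y \notin D) && (par y \in I)].
  have yrt : y \notin rt by apply: contra yD => /(subsetP rtI)/(subsetP sID).
  have yI' : y \notin I by apply: contra yD => /(subsetP sID).
  have parD' : {in y |: D, forall z, z \notin rt -> par z \in I}.
    by move=> z; rewrite !inE => /predU1P[-> | /parD].
  have ltk' : (#|~: (y |: D)| < k)%N.
    rewrite -ltnS; apply: leq_trans ltk; rewrite ltnS; apply/proper_card/properP.
    split; last by exists y; rewrite !inE ?eqxx.
    by apply/subsetP => z; rewrite !inE negb_or => /andP[].
  have splitI L : (L :&: (y |: D) == y |: I) = (y \in L) && (L :&: D == I).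
    apply/eqP/andP => [/setP eqL | [yL /eqP<-]].
      split; first by have := eqL y; rewrite !inE eqxx andbT.
      apply/eqP/setP => z; have := eqL z; rewrite !inE.
      by case: eqP => [-> _|] //; rewrite (negPf yD) (negPf yI') andbF.
    by rewrite setIUr; congr (_ :|: _); apply/setIidPr; rewrite sub1set.
  have splitE L : (L :&: (y |: D) == I) = (y \notin L) && (L :&: D == I).
    apply/eqP/andP => [/setP eqL | [yL /eqP<-]].
      split; first by have := eqL y; rewrite !inE eqxx andbT (negPf yI') => ->.
      apply/eqP/setP => z; have := eqL z; rewrite !inE.
      by case: eqP => [-> _|] //; rewrite (negPf yD) (negPf yI') andbF.
    rewrite setIUr (_ : L :&: [set y] = set0) ?set0U //.
    by apply/setP => z; rewrite !inE andbC; case: eqP => [->|] //=; exact: negbTE.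
  (* A slot is available: [y] itself is an undecided child of [I]. *)
  have decided j :
      (type_count (D :\: rt) j + (j == ty y) <= \sum_i q i * M i j)%N.
    apply: leq_trans (_ : _ <= \sum_i type_count I i * M i j)%N _; last first.
      by apply: leq_sum => i _; rewrite leq_mul2r le_q orbT.
    rewrite -type_countU1 ?inE ?(negPf yD) ?andbF // -card_ch.
    apply/subset_leq_card/subsetP => z; rewrite !inE.
    case/andP=> /predU1P[-> | /andP[zrt zD]] ->; first by rewrite yrt yI.
    by rewrite zrt parD.
  rewrite (@eq_slot_det _ M _ (fun j => (\sum_i q i * M i j
      - type_count ((y |: D) :\: rt) j + (j == ty y))%N) _ _ _ (frefl _)).
    rewrite slot_detS -(cardsID [set L : {set W} | y \in L]) PoszD addrC.
    have := IHk (y |: D) (y |: I); rewrite setUS //.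
    have := IHk (y |: D) I; rewrite (subset_trans sID (subsetUr _ _)).
    move=> /(_ ltk' isT sfI parD') <- /(_ ltk' isT) IH.
    congr (_%:Z + _).
      congr #|pred_of_set _|; apply/setP => L; rewrite !inE splitE.
      by rewrite -!andbA; do !bool_congr.
    rewrite (@eq_slot_det _ M _ _ _ (fun j => (q j)%:Z -
      (type_count (y |: I) j)%:Z) (frefl _)).
      rewrite -IH.
      - congr (#|pred_of_set _|%:Z); apply/setP => L; rewrite !inE splitI.
        by rewrite -!andbA; do !bool_congr.
      - apply/subforestP; split; first exact: subset_trans rtI (subsetUr _ _).
        move=> z zyI zrt; rewrite inE; apply/orP; right.
        by move: zyI zrt; rewrite !inE => /predU1P[-> // | /parI].
      - by move=> z zD zrt; rewrite inE parD' ?orbT.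
    by move=> j; rewrite /= type_countU1 // PoszD opprD addrA.
  move=> j /=; rewrite setDUl (_ : [set y] :\: rt = [set y]); last first.
    by apply/setDidPl; rewrite disjoints1.
  rewrite type_countU1 ?inE ?(negPf yD) ?andbF //.
  rewrite subnDA subnK // -(leq_add2l (type_count (D :\: rt) j)) subnKC ?decided //.
  exact: leq_trans (leq_addr _ _) (decided j).
rewrite negb_exists => /forallP allD.
have {}allD y : par y \in I -> y \in D.
  by move=> yI; have := allD y; rewrite yI andbT negbK.
have decided j : type_count (D :\: rt) j = (\sum_i type_count I i * M i j)%N.
  rewrite -card_ch; apply: eq_card => y; rewrite !inE.
  case: (boolP (y \in rt)) => //= yrt; congr (_ && _).
  by apply/idP/idP => [yD | /allD //]; apply: parD.
have LI L : subforest L -> L :&: D = I -> L = I.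
  move=> sfL LD; apply/eqP; rewrite eqEsubset -{2}LD subsetIl andbT.
  have /subforestP[rtL parL] := sfL.
  apply/subsetP => y; have [k' {}] := ubnP (depth y).
  elim: k' y => // k' IHk' y ltk' yL.
  have [/(subsetP rtI) // | yrt] := boolP (y \in rt).
  rewrite -LD inE yL; apply/allD/IHk'; last exact: parL.
  by rewrite -ltnS -depth_par.
rewrite (@eq_slot_det _ M _ (fun j => \sum_i (q i - type_count I i) * M i j)%N
   _ (fun j => (q j - type_count I j)%N%:Z)); first last.
- by move=> j; rewrite subzn.
- move=> j; rewrite decided -sumnB => [|i _]; last by rewrite leq_mul2r le_q orbT.
  by apply: eq_bigr => i _; rewrite mulnBl.
rewrite slot_det_full; case: forallP => [full | notfull].
  rewrite (_ : quota_subforests D I = [set I]) ?cards1 //.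
  apply/setP => L; rewrite !inE; apply/and3P/eqP => [[sfL /eqP/(LI _ sfL)] //|->].
  split=> //; first by rewrite (setIidPl sID).
  by apply/forallP => j; rewrite eqn_leq le_q /= -subn_eq0; apply: full.
rewrite (_ : quota_subforests D I = set0) ?cards0 //.
apply/setP => L; rewrite !inE; apply/and3P => -[sfL /eqP/(LI _ sfL) -> /forallP qI].
by apply: notfull => j; rewrite -(eqP (qI j)) subnn.
Qed.

End RootedSubforests.

(** * Quota trees as sets of words *)

Lemma walk_rcons (V : finType) (G : multigraph V) x (p : seq (edge G)) e y :
  walk x (rcons p e) y = walk x p (src e) && (tgt e == y).
Proof.
elim: p x => [|e' p IHp] x /=; first by rewrite eq_sym.
by rewrite IHp andbA.
Qed.

(** A word is the sequence of edges of a walk of [G] from [r], the last edge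
    first: the parent of a node is then obtained by [behead], and the type of a
    node is read off the head of its word. *)
Section Words.

Variables (V : finType) (G : multigraph V).

Definition word_end r (w : seq (edge G)) := if w is e :: _ then tgt e else r.

Fixpoint is_word r (w : seq (edge G)) :=
  if w is e :: w' then (src e == word_end r w') && is_word r w' else true.

Lemma is_word_behead r w : is_word r w -> is_word r (behead w).
Proof. by case: w => //= e w /andP[]. Qed.

Section TreeWords.

Variables (r : V) (t : quota_tree G r).
Implicit Types (x y : node t) (f : edge (tree t)).

Lemma root_walk_exists y : exists p : seq (edge (tree t)), walk (Defs.root t) p y.
Proof. by have [p [wp _]] := tree_rooted (q := t) y; exists p. Qed.

Lemma root_walk_inj y (p p' : seq (edge (tree t))) :
  walk (Defs.root t) p y -> walk (Defs.root t) p' y -> p = p'.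
Proof.
by have [p0 [_ p0_uniq]] := tree_rooted (q := t) y => /p0_uniq<- /p0_uniq<-.
Qed.

Definition root_walk y := xchoose (root_walk_exists y).

Lemma root_walkP y : walk (Defs.root t) (root_walk y) y.
Proof. exact: (xchooseP (root_walk_exists y)). Qed.

Definition node_word y : seq (edge G) := rev (map (@emap _ _ _ t) (root_walk y)).

Lemma node_wordE y (p : seq (edge (tree t))) :
  walk (Defs.root t) p y -> node_word y = rev (map (@emap _ _ _ t) p).
Proof. by move=> wp; rewrite /node_word (root_walk_inj (root_walkP y) wp). Qed.

Lemma node_word_root : node_word (Defs.root t) = [::].
Proof. by rewrite (@node_wordE _ [::]) //=. Qed.

Lemma node_word_tgt f : node_word (tgt f) = emap f :: node_word (src f).
Proof.
rewrite (@node_wordE _ (rcons (root_walk (src f)) f)).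
  by rewrite map_rcons rev_rcons.
by rewrite walk_rcons root_walkP eqxx.
Qed.

Lemma node_case y : y = Defs.root t \/ exists f, y = tgt f.
Proof.
have := root_walkP y; case/lastP: (root_walk y) => [|p f] /=.
  by move=> /eqP->; left.
by rewrite walk_rcons => /andP[_ /eqP<-]; right; exists f.
Qed.

Lemma tgt_inj : injective (@tgt _ (tree t)).
Proof.
move=> f f' eq_f; suff: rcons (root_walk (src f)) f = rcons (root_walk (src f')) f'.
  by move/rcons_inj => -[].
by apply: (@root_walk_inj (tgt f)); rewrite walk_rcons root_walkP -?eq_f eqxx.
Qed.

(** By induction, two nodes with the same word have the same parent; the edges
    leading to them from this parent have the same image, so they coincide because
    the map is an immersion. *)
Lemma node_word_inj : injective node_word.
Proof.
move=> y y'; move: {-1}(node_word y) (erefl (node_word y)) => w.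
elim: w y y' => [|e w IHw] y y' wy wy'.
  have [->|[f fy]] := node_case y; last by rewrite fy node_word_tgt in wy.
  by have [->|[f fy]] := node_case y'; last by rewrite fy node_word_tgt in wy'.
have [yr|[f fy]] := node_case y; first by rewrite yr node_word_root in wy.
have [yr|[f' fy']] := node_case y'; first by rewrite yr node_word_root in wy'.
move: wy wy'; rewrite {}fy {}fy' !node_word_tgt => -[ef wf] -[ef' wf'].
have eq_src := IHw _ _ wf wf'; congr tgt.
have [_ /(_ (src f))] := tree_immersion t.
by apply; rewrite ?inE ?eq_src ?ef.
Qed.

Lemma node_word_ind (P : node t -> Prop) :
  P (Defs.root t) -> (forall f, P (src f) -> P (tgt f)) -> forall y, P y.
Proof.
move=> Proot Pstep y; have [k] := ubnP (size (node_word y)).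
elim: k y => // k IHk y; have [-> //|[f ->]] := node_case y.
by rewrite node_word_tgt /= => /IHk/Pstep.
Qed.

Lemma node_word_end y : word_end r (node_word y) = vmap y.
Proof.
have [->|[f ->]] := node_case y; first by rewrite node_word_root tree_root.
by rewrite node_word_tgt /=; have [/(_ f)[]] := tree_immersion t.
Qed.

Lemma is_word_node_word y : is_word r (node_word y).
Proof.
elim/node_word_ind: y => [|f IHf]; first by rewrite node_word_root.
rewrite node_word_tgt /= IHf node_word_end andbT.
by have [/(_ f)[->]] := tree_immersion t.
Qed.

Definition tree_words : seq (seq (edge G)) := codom node_word.

Lemma uniq_tree_words : uniq tree_words.
Proof. by rewrite map_inj_uniq ?enum_uniq //; apply: node_word_inj. Qed.

Lemma nil_tree_words : [::] \in tree_words.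
Proof. by rewrite -node_word_root codom_f. Qed.

Lemma behead_tree_words w : w \in tree_words -> behead w \in tree_words.
Proof.
case/codomP => y ->; have [->|[f ->]] := node_case y.
  by rewrite node_word_root nil_tree_words.
by rewrite node_word_tgt codom_f.
Qed.

Lemma is_word_tree_words w : w \in tree_words -> is_word r w.
Proof. by case/codomP => y ->; apply: is_word_node_word. Qed.

(** The suffixes of a word of the tree are pairwise distinct words of the tree, and
    there is one more of them than letters. *)
Lemma size_tree_words w : w \in tree_words -> (size w < #|node t|)%N.
Proof.
move=> w_in; have drop_in k : drop k w \in tree_words.
  elim: k => [|k IHk]; first by rewrite drop0.
  by rewrite -addn1 addnC -drop_drop drop1 behead_tree_words.
have uniq_drops : uniq [seq drop k w | k <- iota 0 (size w).+1].
  rewrite map_inj_in_uniq ?iota_uniq // => i j.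
  rewrite !mem_iota !add0n !ltnS => /= lei lej /(congr1 size).
  by rewrite !size_drop => eq_ij; rewrite -(subKn lei) eq_ij subKn.
rewrite -(size_codom node_word) -(size_iota 0 (size w).+1).
rewrite -(size_map (fun k => drop k w)); apply: uniq_leq_size uniq_drops _.
by move=> _ /mapP[k _ ->].
Qed.

Lemma tree_quota_words v :
  tree_quota t v = count (fun w => word_end r w == v) tree_words.
Proof.
rewrite /tree_quota cardE size_filter count_map -enumT.
by apply: eq_count => x; rewrite /= inE node_word_end.
Qed.

End TreeWords.

Lemma iso_tree_words r (t t' : quota_tree G r) :
  tree_iso t t' -> tree_words t =i tree_words t'.
Proof.
case=> hv [he [bij_hv bij_he hP h_root [hv_map he_map]]] w.
have hvE y : node_word (hv y) = node_word y.
  elim/node_word_ind: y => [|f IHf]; first by rewrite h_root !node_word_root.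
  have [hsrc htgt] := hP f.
  by rewrite -htgt !node_word_tgt hsrc IHf he_map.
apply/codomP/codomP => [[y ->]|[y' ->]]; first by exists (hv y).
by have [hv' _ hv'K] := bij_hv; exists (hv' y'); rewrite -hvE hv'K.
Qed.

Lemma same_word_node r (t t' : quota_tree G r) :
  {subset tree_words t <= tree_words t'} ->
  exists hv : node t -> node t', forall x : node t, node_word (hv x) = node_word x.
Proof.
move=> sub_tt'.
have hv_ex (x : node t) : exists x' : node t', node_word x' == node_word x.
  by have /codomP[x' ->] := sub_tt' _ (codom_f (@node_word _ t) x); exists x'.
by exists (fun x => xchoose (hv_ex x)) => x; apply/eqP/(xchooseP (hv_ex x)).
Qed.

Lemma same_word_edge r (t t' : quota_tree G r) (hv : node t -> node t') :
  (forall x, node_word (hv x) = node_word x) ->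
  exists he : edge (tree t) -> edge (tree t'),
    forall f : edge (tree t), tgt (he f) = hv (tgt f).
Proof.
move=> hvE.
have he_ex (f : edge (tree t)) : exists f' : edge (tree t'), tgt f' == hv (tgt f).
  have [hv_root|[f' ->]] := node_case (hv (tgt f)); last by exists f'.
  by have := hvE (tgt f); rewrite hv_root node_word_root node_word_tgt.
by exists (fun f => xchoose (he_ex f)) => f; apply/eqP/(xchooseP (he_ex f)).
Qed.

(** Sending a node to the node with the same word, and an edge to the edge that
    enters the image of its target, is an isomorphism; its inverse is built in the
    same way. *)
Lemma tree_words_iso r (t t' : quota_tree G r) :
  tree_words t =i tree_words t' -> tree_iso t t'.
Proof.
move=> eq_tt'.
have [|hv hvE] := @same_word_node r t t'; first by move=> w; rewrite eq_tt'.
have [|hv' hv'E] := @same_word_node r t' t; first by move=> w; rewrite eq_tt'.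
have [he heE] := same_word_edge hvE; have [he' he'E] := same_word_edge hv'E.
have hvK : cancel hv hv' by move=> x; apply: node_word_inj; rewrite hv'E hvE.
have hv'K : cancel hv' hv by move=> x; apply: node_word_inj; rewrite hvE hv'E.
have step (f : edge (tree t)) :
    emap (he f) :: node_word (src (he f)) = emap f :: node_word (src f).
  by rewrite -!node_word_tgt heE hvE.
exists hv, he; split.
- by exists hv'.
- exists he' => f; apply: tgt_inj; first by rewrite he'E heE hvK.
  by rewrite heE he'E hv'K.
- move=> f; split; last exact: heE.
  by apply: node_word_inj; rewrite hvE; have [] := step f.
- by apply: node_word_inj; rewrite hvE !node_word_root.
- split=> [x|f]; last by have [] := step f.
  by rewrite -!node_word_end hvE.
Qed.

End Words.

(** Nodes are words, and the arc entering a nonempty word is that word together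
    with its first letter, from its [behead]. *)
Lemma tree_of_words (V : finType) (G : multigraph V) r (L : seq (seq (edge G))) :
  [::] \in L -> {in L, forall w, behead w \in L} -> {in L, forall w, is_word r w} ->
  {t : quota_tree G r | tree_words t =i L}.
Proof.
move=> nilL beheadL wordL.
pose node := seq_sub L; pose root : node := SeqSub nilL.
pose up (y : node) : node := SeqSub (beheadL _ (valP y)).
(* Storing the label in the arc avoids a default value for the head of an
   empty word. *)
pose arc : finType := {p : edge G * node | ohead (val p.2) == Some p.1}.
pose T := @Multigraph node arc (fun f => up (val f).2) (fun f => (val f).2).
pose label (f : edge T) := (val f).1; pose end_of (y : node) := word_end r (val y).
have arcE (f : edge T) : val (tgt f) = label f :: val (src f).
  by have := valP f; rewrite /label /=; case: (ssval _) => //= e w /eqP[->].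
have arc_inj (f f' : edge T) : tgt f = tgt f' -> f = f'.
  move=> eq_f; have := arcE f; rewrite eq_f arcE => -[eq_l _].
  apply/val_inj; rewrite [LHS]surjective_pairing [RHS]surjective_pairing.
  by congr (_, _).
have rooted : rooted_tree T root.
  move=> y; have [k] := ubnP (size (val y)); elim: k y => // k IHk y ltk.
  case def_y: (val y) => [|e w].
    have -> : y = root by apply: val_inj.
    exists [::]; split=> [|p]; first exact: eqxx.
    case/lastP: p => // p f; rewrite walk_rcons => /andP[_ /eqP tgt_f].
    by have := arcE f; rewrite tgt_f.
  have fP : ohead (val (e, y).2) == Some (e, y).1 by rewrite /= def_y.
  pose f : edge T := exist _ (e, y) fP.
  have [|p [wp p_uniq]] := IHk (src f).
    by move: ltk; rewrite -[val (src f)]/(behead (val y)) def_y.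
  exists (rcons p f); split=> [|p']; first by rewrite walk_rcons wp eqxx.
  case/lastP: p' => [/eqP yr | p' f'].
    by rewrite -yr in def_y.
  rewrite walk_rcons => /andP[wp' /eqP tgt_f'].
  have <- : f = f' by apply: arc_inj.
  by congr rcons; apply: p_uniq; rewrite -(arc_inj f f') in wp'.
have imm : immersion (T := T) (G := G) end_of label.
  split=> [f | v f f'].
    have := wordL _ (valP (tgt f)); rewrite /= -[ssval _]/(val (tgt f)) arcE /=.
    case/andP=> /eqP-> _; split=> //.
    by rewrite /end_of arcE.
  rewrite !inE => /eqP sf /eqP sf' eq_l; apply: arc_inj; apply: val_inj.
  by rewrite !arcE eq_l sf sf'.
pose t := @QuotaTree V G r node T root end_of label rooted imm (erefl _).
exists t => w; have wordE (y : Defs.node t) : node_word y = val y.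
  elim/node_word_ind: y => [|f IHf]; first by rewrite node_word_root.
  by rewrite node_word_tgt IHf -[RHS]/(val (@tgt _ T f)) arcE.
apply/codomP/idP => [[y ->]|wL]; first by rewrite wordE (valP y).
by exists (SeqSub wL : Defs.node t); rewrite wordE.
Qed.

(** * Quota forests as subforests of the forest of words *)

(** The cells are the pairs of a root index and a word of length at most [m] from
    that root.  They form the ambient forest; the bound makes it finite, and
    words of a quota forest are shorter than its total quota. *)
Section Forests.

Variables (n : nat) (G : multigraph 'I_n) (s : 'rV[nat]_n) (m : nat).

Definition root_index : finType := {v : 'I_n & 'I_(s 0 v)}.

Definition cell : finType :=
  {x : root_index * {bseq m of edge G} | is_word (tag x.1) x.2}.

Implicit Types (i : root_index) (w : seq (edge G)) (x y : cell) (L : {set cell}).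

Definition cell_root x : root_index := (val x).1.
Definition cell_word x : seq (edge G) := (val x).2.
Definition cell_type x : 'I_n := word_end (tag (cell_root x)) (cell_word x).

Lemma cell_inj x y : cell_root x = cell_root y -> cell_word x = cell_word y -> x = y.
Proof.
move=> eq_r eq_w; apply/val_inj.
rewrite [LHS]surjective_pairing [RHS]surjective_pairing.
by congr (_, _); last exact: val_inj.
Qed.

Lemma cell_exists i w :
  is_word (tag i) w -> (size w <= m)%N ->
  {x | cell_root x = i & cell_word x = w}.
Proof. by move=> wP szw; exists (exist _ (i, Bseq szw) wP). Qed.

Lemma cell_wordP x : is_word (tag (cell_root x)) (cell_word x).
Proof. exact: valP x. Qed.

Lemma size_cell_word x : (size (cell_word x) <= m)%N.
Proof. exact: size_bseq. Qed.

Lemma parent_exists x :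
  {y | cell_root y = cell_root x & cell_word y = behead (cell_word x)}.
Proof.
apply: cell_exists; first exact/is_word_behead/cell_wordP.
by rewrite size_behead; apply: leq_trans (leq_pred _) (size_cell_word x).
Qed.

Definition parent x := s2val (parent_exists x).

Lemma cell_root_parent x : cell_root (parent x) = cell_root x.
Proof. exact: s2valP (parent_exists x). Qed.

Lemma cell_word_parent x : cell_word (parent x) = behead (cell_word x).
Proof. exact: s2valP' (parent_exists x). Qed.

Definition root_cells : {set cell} := [set x | cell_word x == [::]].

(** The children of a cell correspond to the edges leaving its type, by the
    first letter of the word. *)
Lemma card_child_cells x j : (size (cell_word x) < m)%N ->
  #|[set y | [&& y \notin root_cells, parent y == x & cell_type y == j]]|
  = adjmx G (cell_type x) j.
Proof.
move=> ltm; rewrite mxE; set A := [set y | _]; set B := [set e | _].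
have childE y : y \in A -> exists e,
    [/\ cell_word y = e :: cell_word x, cell_root y = cell_root x & tgt e = j].
  rewrite !inE => /and3P[]; case def_y: (cell_word y) => [//|e w] _ /eqP<-.
  rewrite /cell_type def_y => /eqP tgt_e; exists e.
  by rewrite cell_word_parent cell_root_parent def_y.
rewrite -(card_in_imset (f := fun y => ohead (cell_word y)) (D := A)); last first.
  move=> y y' /childE[e [wy ry _]] /childE[e' [wy' ry' _]].
  rewrite wy wy' => -[eq_e]; apply: cell_inj; first by rewrite ry ry'.
  by rewrite wy wy' eq_e.
rewrite -(card_imset (mem B) (@Some_inj _)); apply: eq_card => oe.
apply/imsetP/imsetP => [[y yA ->] | [e]].
  have [e [wy ry tgt_e]] := childE y yA; exists e; last by rewrite wy.
  have := cell_wordP y; rewrite wy /= ry => /andP[src_e _].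
  by rewrite inE src_e tgt_e eqxx.
rewrite inE => /andP[src_e /eqP tgt_e] ->.
have [|//|y ry wy] := @cell_exists (cell_root x) (e :: cell_word x).
  by rewrite /= src_e cell_wordP.
exists y; last by rewrite wy.
rewrite !inE wy /=; apply/andP; split; last by rewrite /cell_type wy /= tgt_e.
by apply/eqP/cell_inj; rewrite ?cell_root_parent ?cell_word_parent ?wy.
Qed.

Lemma card_root_cells v : type_count cell_type root_cells v = s 0 v.
Proof.
rewrite /type_count -(card_in_imset (f := cell_root)); last first.
  move=> x y; rewrite !inE => /andP[/eqP wx _] /andP[/eqP wy _] eq_r.
  by apply: cell_inj; rewrite // wx wy.
pose root_at u (k : 'I_(s 0 u)) : root_index := Tagged (fun u => 'I_(s 0 u)) k.
rewrite -[RHS]card_ord -(card_imset _ (f := root_at v)).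
  apply: eq_card => i; apply/imsetP/imsetP => [[x]|[k _ ->]].
    rewrite !inE /cell_type => /andP[/eqP-> /= /eqP<-] ->.
    by exists (tagged (cell_root x)); case: (cell_root x).
  have [//|//|x rx wx] := @cell_exists (root_at v k) [::].
  by exists x; rewrite // !inE wx /cell_type rx wx /= !eqxx.
by move=> k k' /eqP; rewrite eq_Tagged => /eqP.
Qed.

Definition words_at L i : seq (seq (edge G)) :=
  [seq cell_word x | x in [set x in L | cell_root x == i]].

Lemma mem_words_at L x : (cell_word x \in words_at L (cell_root x)) = (x \in L).
Proof.
apply/imageP/idP => [[y] | xL]; last by exists x; rewrite ?inE ?xL ?eqxx.
by rewrite inE => /andP[yL /eqP eq_r] /(cell_inj (esym eq_r))->.
Qed.

Lemma words_atP L i w :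
  reflect (exists x, [/\ x \in L, cell_root x = i & cell_word x = w])
    (w \in words_at L i).
Proof.
apply: (iffP imageP) => [[x] | [x [xL rx wx]]].
  by rewrite inE => /andP[xL /eqP rx] ->; exists x.
by exists x; rewrite // inE xL rx eqxx.
Qed.

Definition tree_at (F : quota_forest G s) i := F (tag i) (tagged i).

(** The two sides agree index by index of the roots: the words of the tree at [i]
    and the cells of [L] with root index [i] are in bijection. *)
Lemma forest_quota_words (F : quota_forest G s) L v :
  (forall i, tree_words (tree_at F i) =i words_at L i) ->
  forest_quota F 0 v = type_count cell_type L v.
Proof.
move=> FL; rewrite mxE (sig_big_dep _ _ (fun v' k => tree_quota (F v' k) v)) /=.
rewrite /type_count -sum1_card (partition_big cell_root predT) //=.
apply: eq_bigr => i _; rewrite -/(tree_at F i) tree_quota_words.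
pose C := [set x in L | (cell_type x == v) && (cell_root x == i)].
transitivity #|C|; last first.
  by rewrite -sum1_card; apply: eq_bigl => x; rewrite !inE andbA.
have uniqC : uniq [seq cell_word x | x in C].
  rewrite map_inj_in_uniq ?enum_uniq // => x y; rewrite !mem_enum !inE.
  by move=> /and3P[_ _ /eqP rx] /and3P[_ _ /eqP ry]; apply: cell_inj; rewrite rx ry.
rewrite -size_filter -(size_image cell_word C); apply/perm_size/uniq_perm => //.
  exact/filter_uniq/uniq_tree_words.
move=> w; rewrite mem_filter FL; apply/andP/imageP.
  case=> /eqP we /words_atP[x [xL rx wx]].
  by exists x; rewrite // !inE xL /cell_type rx wx we !eqxx.
case=> x; rewrite !inE => /and3P[xL /eqP tx /eqP rx] ->.
by split; [rewrite -rx -tx | apply/words_atP; exists x].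
Qed.

Definition good_subforest := subforest parent root_cells.

Lemma forest_of_subforest L : good_subforest L ->
  {F : quota_forest G s | forall i, tree_words (tree_at F i) =i words_at L i}.
Proof.
move=> /subforestP[rootL parentL].
have tree_i i : {t : quota_tree G (tag i) | tree_words t =i words_at L i}.
  apply: tree_of_words => [|w|w].
  - have [//|//|x rx wx] := @cell_exists i [::].
    by apply/words_atP; exists x; split=> //; apply: (subsetP rootL); rewrite inE wx.
  - case/words_atP => x [xL rx <-].
    have [xrt|xrt] := boolP (x \in root_cells).
      have wx : cell_word x = [::] by move: xrt; rewrite inE => /eqP.
      by apply/words_atP; exists x; rewrite wx.
    apply/words_atP; exists (parent x).
    by rewrite cell_root_parent cell_word_parent parentL.
  - by case/words_atP => x [_ <- <-]; apply: cell_wordP.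
by exists (fun v k => sval (tree_i (Tagged _ k))) => -[v k]; apply: (svalP (tree_i _)).
Qed.

Lemma subforest_of_forest (F : quota_forest G s) :
  (forall i w, w \in tree_words (tree_at F i) -> (size w <= m)%N) ->
  exists2 L, good_subforest L & forall i, tree_words (tree_at F i) =i words_at L i.
Proof.
move=> small.
exists [set x | cell_word x \in tree_words (tree_at F (cell_root x))].
  apply/subforestP; split=> [|x].
    by apply/subsetP => x; rewrite !inE => /eqP->; apply: nil_tree_words.
  rewrite !inE cell_root_parent cell_word_parent => xF _.
  exact: behead_tree_words.
move=> i w; apply/idP/words_atP => [wF | [x [+ <- <-]]]; last by rewrite inE.
have [||x rx wx] := @cell_exists i w; first exact: is_word_tree_words wF.
  exact: small wF.
by exists x; rewrite inE rx wx.
Qed.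

End Forests.

Lemma size_forest_words n (G : multigraph 'I_n) (s : 'rV[nat]_n)
    (F : quota_forest G s) i w :
  w \in tree_words (tree_at F i) -> (size w <= \sum_v forest_quota F 0%R v)%N.
Proof.
move=> /size_tree_words/ltnW/leq_trans; apply.
rewrite -sum1_card (partition_big (@vmap _ _ _ (tree_at F i)) predT) //=.
apply: leq_sum => v _; rewrite mxE (bigD1 (tag i)) //= (bigD1 (tagged i)) //=.
rewrite -addnA; apply: leq_trans (leq_addr _ _).
by rewrite sum1_card /tree_quota cardsE.
Qed.

Theorem theorem5 (n : nat) (G : multigraph 'I_n) (q s : 'rV[nat]_n) :
  exists N : nat,
    count_upto (@forest_iso n G s)
      (fun F : quota_forest G s => forest_quota F = q) N /\
    N%:R = quota_symbol G (rowz (q *m adjmx G)) (rowz q - rowz s).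
Proof.
pose m := (\sum_v q 0%R v)%N.
pose cells := @cell n G s m; pose rt := @root_cells n G s m.
pose ty := @cell_type n G s m.
pose Ls := quota_subforests (@parent n G s m) rt ty (q 0) rt rt.
have LsP (L : {set cells}) :
    reflect (good_subforest L /\ forall v, type_count ty L v = q 0 v) (L \in Ls).
  rewrite inE; apply: (iffP and3P) => [[sfL _ /forallP qL]|[sfL qL]].
    by split=> // v; apply/eqP.
  split=> //; first by have /subforestP[/setIidPr->] := sfL.
  by apply/forallP => v; rewrite qL.
exists #|Ls|; split.
  have LsW (k : 'I_#|Ls|) : good_subforest (enum_val k).
    by have /LsP[] := enum_valP k.
  pose rep k := sval (forest_of_subforest (LsW k)).
  have repE k i : tree_words (tree_at (rep k) i) =i words_at (enum_val k) i.
    exact: svalP (forest_of_subforest (LsW k)) i.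
  exists rep; split=> [k | k k' iso_kk' | F qF].
  - apply/rowP => v; rewrite (forest_quota_words _ (repE k)).
    by have /LsP[_ ->] := enum_valP k.
  - apply: enum_val_inj; apply/setP => x.
    have /iso_tree_words eq_w := iso_kk' (tag (cell_root x)) (tagged (cell_root x)).
    by rewrite -[LHS]mem_words_at -[RHS]mem_words_at -!repE eq_w.
  - have [i w|L sfL FL] := @subforest_of_forest n G s m F.
      by move/size_forest_words; rewrite qF.
    have LLs : L \in Ls.
      by apply/LsP; split=> // v; rewrite -(forest_quota_words _ FL) qF.
    exists (enum_rank_in LLs L) => v k; apply: tree_words_iso => w.
    have := repE (enum_rank_in LLs L) (Tagged _ k) w.
    by rewrite enum_rankK_in // -FL => ->.
rewrite quota_symbolE pmulrn; congr (_%:~R).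
have sf_rt : good_subforest rt.
  by apply/subforestP; split=> // x ->.
rewrite (card_quota_subforests (m := m) (depth := fun x => size (cell_word x))
  (M := adjmx G)) //.
- apply: eq_slot_det => v; last by rewrite card_root_cells.
  rewrite setDv (_ : type_count _ _ _ = 0%N) ?subn0 //.
  by apply: eq_card0 => x; rewrite !inE.
- by move=> x; rewrite inE => /eqP->.
- by move=> x; rewrite inE cell_word_parent; case: (cell_word x).
- by move=> x j; apply: card_child_cells.
- by move=> x ->.
Qed.
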